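(* There is an algorithm for testing whether an unweighted graph $G$ with $n$ vertices is a clique (i.e., whether $G=K_n$) using $O(n)$ effective resistance queries, but any algorithm for this task that uses shortest path queries requires $\Omega(n^2)$ shortest path queries.
   Context: The graph is hidden on a known vertex set. An effective resistance query on $u,v$ returns $R(u,v)=(\mathbf{1}_u-\mathbf{1}_v)^TL^+(\mathbf{1}_u-\mathbf{1}_v)$, where $L$ is the Laplacian of $G$ (unit edge conductances) and $L^+$ its pseudoinverse. A shortest path query on $u,v$ returns the length (number of edges) of a shortest $u$–$v$ path in $G$. *)

(* Defs.v *)
From HB Require Import structures.
From mathcomp Require Import all_boot all_order all_algebra.
From mathcomp Require Import all_classical all_reals all_analysis.

Set Implicit Arguments.
Unset Strict Implicit.
Unset Printing Implicit Defensive.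

Import Order.TTheory GRing.Theory Num.Theory.

Local Open Scope ring_scope.

(** * Simple graphs on the vertex set 'I_n *)

Record sgraph (n : nat) := SGraph {
  adj :> rel 'I_n;
  adj_sym : symmetric adj;
  adj_irr : irreflexive adj }.

Lemma neq_sym n : symmetric (fun u v : 'I_n => u != v).
Proof. by move=> u v; rewrite eq_sym. Qed.

Lemma neq_irr n : irreflexive (fun u v : 'I_n => u != v).
Proof. by move=> u; rewrite eqxx. Qed.

Definition complete_graph (n : nat) : sgraph n :=
  SGraph (@neq_sym n) (@neq_irr n).

Definition is_clique n (G : sgraph n) : bool :=
  [forall u, forall v, adj G u v == adj (complete_graph n) u v].

(** * Shortest path queries *)

Definition has_path n (G : sgraph n) (u v : 'I_n) (k : nat) : bool :=
  [exists p : k.-tuple 'I_n,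
     [&& path (adj G) u p, last u p == v & uniq (u :: p)]].

(* The least length of a u-v path, or None if u and v are disconnected; a path
   has pairwise distinct vertices, so only lengths below n can occur
   (see sp_distP). *)
Definition sp_dist n (G : sgraph n) (u v : 'I_n) : option nat :=
  ohead [seq k <- iota 0 n | has_path G u v k].

Lemma has_path_lt n (G : sgraph n) u v k : has_path G u v k -> (k < n)%N.
Proof.
case/existsP=> p /and3P[_ _ /card_uniqP] /= cp.
by have := max_card [in (u :: p)]; rewrite cp size_tuple card_ord.
Qed.

Lemma ohead_filter_iota (P : pred nat) m l :
  match ohead [seq k <- iota m l | P k] with
  | Some k => [/\ P k, (m <= k)%N & forall j, (m <= j < m + l)%N -> P j -> (k <= j)%N]
  | None => forall j, (m <= j < m + l)%N -> ~~ P j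
  end.
Proof.
elim: l m => [|l IHl] m /=.
  by move=> j; rewrite addn0 => /andP[mj jm]; move: (leq_ltn_trans mj jm); rewrite ltnn.
case: ifPn => [Pm|nPm] /=; first by split=> // j /andP[].
have := IHl m.+1; case: ohead => [k|] IH.
  case: IH => Pk mk H; split=> // [|j /andP[mj jm] Pj]; first exact: ltnW.
  apply: H => //; rewrite addSnnS jm andbT ltn_neqAle mj andbT.
  by apply: contra nPm => /eqP ->.
move=> j /andP[]; rewrite leq_eqVlt => /predU1P[<- //|mj jm].
by apply: IH; rewrite mj addSnnS.
Qed.

Lemma sp_distP n (G : sgraph n) u v :
  match sp_dist G u v with
  | Some k => has_path G u v k /\ forall j, has_path G u v j -> (k <= j)%N
  | None => forall j, ~~ has_path G u v j
  end.
Proof.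
rewrite /sp_dist; have := ohead_filter_iota (has_path G u v) 0 n.
case: ohead => [k [hk _ H]|H]; first split=> // j hj.
  by apply: H => //=; apply: has_path_lt hj.
by move=> j; apply/negP => hj; have := H j (has_path_lt hj); rewrite hj.
Qed.

(** * Moore-Penrose pseudoinverse *)

Definition penrose (F : fieldType) m n (A : 'M[F]_(m, n)) (B : 'M[F]_(n, m)) :=
  [/\ A *m B *m A = A, B *m A *m B = B,
      (A *m B)^T = A *m B & (B *m A)^T = B *m A].

(* The formula for A^+ from a full-rank factorization A = C *m D. Not to be
   confused with pinvmx, which only satisfies the first Penrose condition. *)
Definition mpinv (F : realFieldType) m n (A : 'M[F]_(m, n)) : 'M[F]_(n, m) :=
  let C := col_base A in let D := row_base A in
  D^T *m invmx (D *m D^T) *m invmx (C^T *m C) *m C^T.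

Lemma gram_unit (F : realFieldType) m n (D : 'M[F]_(m, n)) :
  row_free D -> D *m D^T \in unitmx.
Proof.
move=> fD; rewrite -row_free_unit; apply: inj_row_free => v.
rewrite mulmxA => vDD.
have : (v *m D) *m (v *m D)^T = 0 by rewrite trmx_mul mulmxA vDD mul0mx.
move/matrixP/(_ 0 0); rewrite mxE [RHS]mxE => /eqP.
rewrite psumr_eq0 => [/allP vD|i _]; last first.
  by rewrite [(v *m D)^T _ _]mxE -expr2 sqr_ge0.
apply: (row_free_inj fD); rewrite mul0mx; apply/rowP => i.
have := vD i (mem_index_enum i).
by rewrite /= [(v *m D)^T _ _]mxE mulf_eq0 orbb [RHS]mxE => /eqP.
Qed.

Lemma penrose_full_rank (F : realFieldType) m n r
    (C : 'M[F]_(m, r)) (D : 'M[F]_(r, n)) :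
  row_full C -> row_free D ->
  penrose (C *m D) (D^T *m invmx (D *m D^T) *m invmx (C^T *m C) *m C^T).
Proof.
move=> fC fD.
have uD : D *m D^T \in unitmx by apply: gram_unit.
have uC : C^T *m C \in unitmx.
  by rewrite -{2}[C]trmxK; apply: gram_unit; rewrite /row_free mxrank_tr.
set X := invmx (D *m D^T); set Y := invmx (C^T *m C).
have XT : X^T = X by rewrite trmx_inv trmx_mul trmxK.
have YT : Y^T = Y by rewrite trmx_inv trmx_mul trmxK.
set B := _ *m C^T.
have AB : C *m D *m B = C *m Y *m C^T.
  by rewrite /B !mulmxA -(mulmxA C D) -(mulmxA C _ X) mulmxV // mulmx1.
have BA : B *m (C *m D) = D^T *m X *m D.
  rewrite /B !mulmxA -(mulmxA _ C^T C) -(mulmxA _ Y).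
  by rewrite mulVmx // mulmx1.
split.
- rewrite AB !mulmxA -(mulmxA _ C^T C) -(mulmxA _ Y).
  by rewrite mulVmx // mulmx1.
- rewrite BA /B !mulmxA -(mulmxA _ D D^T) -(mulmxA _ (D *m D^T)).
  by rewrite mulmxV // mulmx1.
- by rewrite AB !trmx_mul trmxK YT mulmxA.
- by rewrite BA !trmx_mul trmxK XT mulmxA.
Qed.

Lemma mpinvP (F : realFieldType) m n (A : 'M[F]_(m, n)) : penrose A (mpinv A).
Proof.
have := penrose_full_rank (col_base_full A) (row_base_free A).
by rewrite mulmx_base.
Qed.

Lemma penrose_unique (F : fieldType) m n (A : 'M[F]_(m, n)) B B' :
  penrose A B -> penrose A B' -> B = B'.
Proof.
move=> [b1 b2 b3 b4] [c1 c2 c3 c4].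
have AB : A *m B = A *m B'.
  by rewrite -[in LHS]c1 -mulmxA -[LHS]trmxK trmx_mul b3 c3 mulmxA b1 c3.
have BA : B *m A = B' *m A.
  by rewrite -[in LHS]c1 -!mulmxA mulmxA -[LHS]trmxK trmx_mul b4 c4 -mulmxA
             [A *m (B *m A)]mulmxA b1 c4.
by rewrite -b2 BA -mulmxA AB mulmxA c2.
Qed.

(** * Effective resistance queries *)

Definition laplacian (R : realType) n (G : sgraph n) : 'M[R]_n :=
  \matrix_(u, v) (if u == v then #|[set w | adj G u w]|%:R
                  else - (adj G u v)%:R).

Definition eff_res (R : realType) n (G : sgraph n) (u v : 'I_n) : R :=
  let x : 'cV[R]_n := delta_mx u 0 - delta_mx v 0 in
  (x^T *m mpinv (laplacian R G) *m x) 0 0.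

(** * Query algorithms *)

(* Adaptive decision trees: each query is a pair of vertices, and the rest of
   the computation may depend arbitrarily on the answer received. *)
Inductive qalg (V A : Type) : Type :=
  | Output of bool
  | Query of V & V & (A -> qalg V A).
Arguments Output {V A}.

Section Execution.
Variables (V A : Type) (oracle : V -> V -> A).

Fixpoint output (T : qalg V A) : bool :=
  match T with
  | Output b => b
  | Query u v k => output (k (oracle u v))
  end.

Fixpoint num_queries (T : qalg V A) : nat :=
  match T with
  | Output _ => 0
  | Query u v k => (num_queries (k (oracle u v))).+1
  end.

End Execution.

(* A randomized algorithm is a random decision tree A w, with w drawn from P; it
   must answer correctly with probability at least 2/3 on every input graph.
   Deterministic, always correct algorithms are a special case
   (see deterministic_sp_tester). *)
Definition randomized_sp_clique_tester (R : realType) (n : nat)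
    (d : measure_display) (Omega : measurableType d) (P : probability Omega R)
    (A : Omega -> qalg 'I_n (option nat)) : Prop :=
  forall G : sgraph n,
    measurable [set w | output (sp_dist G) (A w)]%classic /\
    ((2 / 3 : R)%:E <=
       P [set w | output (sp_dist G) (A w) = is_clique G]%classic)%E.

Lemma deterministic_sp_tester (R : realType) n (d : measure_display)
    (Omega : measurableType d) (P : probability Omega R)
    (T : qalg 'I_n (option nat)) :
  (forall G : sgraph n, output (sp_dist G) T = is_clique G) ->
  randomized_sp_clique_tester P (fun=> T).
Proof.
move=> HT G; split.
  case: (output _ _).
  - by rewrite (_ : [set _ | _]%classic = setT) //; apply/seteqP; split.
  - by rewrite (_ : [set _ | _]%classic = set0) //; apply/seteqP; split.
rewrite (_ : [set _ | _]%classic = setT); last by apply/seteqP; split=> // w _; apply: HT.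
by rewrite probability_setT lee_fin ler_pdivrMr ?ltr0n // mul1r ler_nat.
Qed.

(* Main.v *)
Require Import Defs.
From HB Require Import structures.
From mathcomp Require Import all_boot all_order all_algebra.
From mathcomp Require Import all_classical all_reals all_analysis.
From mathcomp Require Import measurable_realfun zify ring lra.

Set Implicit Arguments.
Unset Strict Implicit.
Unset Printing Implicit Defensive.

Import Order.TTheory GRing.Theory Num.Theory.

Local Open Scope ring_scope.

(** Upper bound: if [u] and [v] are adjacent and [x = 1_u - 1_v], the Laplacian
    energy [R(u,v) - 2 t x^T x + t^2 x^T L x] of [L^+ x - t x] is nonnegative for
    every [t], so [R(u,v) >= 4 / (deg u + deg v + 2)].  Hence [R(u,v) = 2/n], the value
    in [K_n], forces [deg u = deg v = n - 1].  The pseudoinverse also assigns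
    finite values to disconnected pairs, so that querying all pairs at one vertex
    might be fooled when that vertex is isolated; querying all pairs at two
    distinct vertices is enough, because two isolated vertices have resistance 0.

    Lower bound: all the answers on [K_n] and on [K_n] minus an edge [e] agree,
    except on [e].  A tester has to distinguish the two graphs with probability
    at least 1/3, and a decision tree can distinguish [K_n] from [K_n - e] only
    for those [e] that it queries on [K_n]; averaging over [e] gives a tree with
    quadratically many queries. *)

(** * Laplacian energy and effective resistance *)

Section Resistance.
Variables (R : realType) (n : nat).
Implicit Types (G : sgraph n) (u v : 'I_n).

Local Notation deg G u := #|[set w | adj G u w]|.
Local Notation dipole u v := (delta_mx u 0 - delta_mx v 0 : 'cV[R]_n).

Lemma trmx_laplacian G : (laplacian R G)^T = laplacian R G.
Proof.
apply/matrixP => u v; rewrite !mxE eq_sym adj_sym.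
by case: eqVneq => // ->.
Qed.

Lemma degE G u : (deg G u)%:R = \sum_w (adj G u w)%:R :> R.
Proof.
rewrite -sum1_card natr_sum big_mkcond /=; apply: eq_bigr => w _.
by rewrite inE; case: adj.
Qed.

Lemma laplacian_mulE G (z : 'cV[R]_n) u :
  (laplacian R G *m z) u 0 = \sum_v (adj G u v)%:R * (z u 0 - z v 0).
Proof.
under [RHS]eq_bigr => v _ do rewrite mulrBr.
rewrite sumrB -mulr_suml -degE mxE (bigD1 u) //= mxE eqxx; congr (_ + _).
rewrite [in RHS](bigD1 u) //= adj_irr mul0r add0r -sumrN.
by apply: eq_bigr => v vu; rewrite mxE eq_sym (negPf vu) mulNr.
Qed.

(** The sum runs over ordered pairs, so each edge is counted twice; the square appears on adding the
    expansion of [z^T L z] to its copy with [u] and [v] exchanged. *)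
Lemma laplacian_energy G (z : 'cV[R]_n) :
  (z^T *m laplacian R G *m z) 0 0 *+ 2 =
  \sum_u \sum_v (adj G u v)%:R * (z u 0 - z v 0) ^+ 2.
Proof.
have E : (z^T *m laplacian R G *m z) 0 0 =
    \sum_u \sum_v (adj G u v)%:R * (z u 0 * (z u 0 - z v 0)).
  rewrite -mulmxA mxE; apply: eq_bigr => u _.
  rewrite laplacian_mulE mxE mulr_sumr; apply: eq_bigr => v _; ring.
rewrite mulr2n E [X in X + _]exchange_big /= -big_split /=; apply: eq_bigr => u _.
rewrite -big_split; apply: eq_bigr => v _ /=.
rewrite [adj G v u]adj_sym; ring.
Qed.

Lemma laplacian_energy_ge0 G (z : 'cV[R]_n) :
  0 <= (z^T *m laplacian R G *m z) 0 0.
Proof.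
rewrite -(pmulrn_lge0 _ (ltn0Sn 1)) laplacian_energy.
by do 2![apply: sumr_ge0 => ? _]; rewrite mulr_ge0 ?sqr_ge0 ?ler0n.
Qed.

Lemma laplacian_ker_adj G (z : 'cV[R]_n) u v :
  laplacian R G *m z = 0 -> adj G u v -> z u 0 = z v 0.
Proof.
move=> Lz uv; have := laplacian_energy G z.
rewrite -mulmxA Lz mulmx0 mxE mul0rn => /esym/eqP.
have ge0 i j : 0 <= (adj G i j)%:R * (z i 0 - z j 0) ^+ 2.
  by rewrite mulr_ge0 ?sqr_ge0 ?ler0n.
rewrite psumr_eq0 => [/allP/(_ u (mem_index_enum u))/=|i _]; last exact: sumr_ge0.
rewrite psumr_eq0 // => /allP/(_ v (mem_index_enum v))/=.
by rewrite uv mul1r sqrf_eq0 subr_eq0 => /eqP.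
Qed.

Lemma dipole_mulE (M : 'M[R]_n) u v :
  ((dipole u v)^T *m M *m dipole u v) 0 0 = M u u - M u v - M v u + M v v.
Proof.
rewrite [(_ - _)^T]linearB /= !trmx_delta mulmxBl -!rowE mulmxBr -!colE !mxE; ring.
Qed.

(** Columns of [M] lie in the kernel of the Laplacian, hence agree at the ends of an edge. Applied
    below to the projections [1 - L L^+] and [1 - L^+ L]. *)
Lemma dipole_laplacian_ker G u v (M : 'M[R]_n) :
  adj G u v -> laplacian R G *m M = 0 -> (dipole u v)^T *m M = 0.
Proof.
move=> uv LM; rewrite [(_ - _)^T]linearB /= !trmx_delta mulmxBl -!rowE.
apply/rowP => j; rewrite !mxE.
have := @laplacian_ker_adj G (col j M) u v; rewrite !mxE => -> //.
  by rewrite subrr.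
by rewrite colE mulmxA LM mul0mx.
Qed.

(** [L L^+] is the orthogonal projection onto the range of [L]. Adjacency puts the dipole in that
    range even when [G] is disconnected. *)
Lemma laplacian_mpinv_dipole G u v : adj G u v ->
  laplacian R G *m (mpinv (laplacian R G) *m dipole u v) = dipole u v.
Proof.
move=> uv; have [p1 _ p3 _] := mpinvP (laplacian R G).
set L := laplacian R G in p1 p3 *; set P := L *m mpinv L in p1 p3.
have /(dipole_laplacian_ker uv) : L *m (1%:M - P) = 0.
  apply: trmx_inj; rewrite trmx_mul [(_ - _)^T]linearB /= trmx1 p3 trmx_laplacian.
  by rewrite mulmxBl mul1mx p1 subrr trmx0.
rewrite mulmxBr mulmx1 => /subr0_eq /(congr1 trmx).
by rewrite trmx_mul p3 trmxK mulmxA => <-.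
Qed.

Lemma mpinv_laplacian_dipole G u v : adj G u v ->
  mpinv (laplacian R G) *m (laplacian R G *m dipole u v) = dipole u v.
Proof.
move=> uv; have [p1 _ _ p4] := mpinvP (laplacian R G).
have /(dipole_laplacian_ker uv) :
    laplacian R G *m (1%:M - mpinv (laplacian R G) *m laplacian R G) = 0.
  by rewrite mulmxBr mulmx1 mulmxA p1 subrr.
rewrite mulmxBr mulmx1 => /subr0_eq /(congr1 trmx).
by rewrite trmx_mul p4 trmxK mulmxA => <-.
Qed.

Lemma dipole_energy G u v : adj G u v ->
  ((dipole u v)^T *m laplacian R G *m dipole u v) 0 0
    = (deg G u + deg G v + 2)%:R.
Proof.
move=> uv; have vu : adj G v u by rewrite adj_sym.
have nuv : u != v by apply: contraTneq uv => ->; rewrite adj_irr.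
rewrite dipole_mulE !mxE !eqxx (negPf nuv) eq_sym (negPf nuv) uv vu !natrD.
rewrite !opprK /=; ring.
Qed.

Lemma dipole_norm u v : u != v -> ((dipole u v)^T *m dipole u v) 0 0 = 2.
Proof.
move=> nuv; rewrite -[X in X *m _]mulmx1 dipole_mulE !mxE !eqxx (negPf nuv).
rewrite eq_sym (negPf nuv) /=; ring.
Qed.

Lemma eff_res_adj_ge G u v (t : R) : adj G u v ->
  4 * t - t ^+ 2 * (deg G u + deg G v + 2)%:R <= eff_res R G u v.
Proof.
move=> uv; have nuv : u != v by apply: contraTneq uv => ->; rewrite adj_irr.
rewrite /eff_res -dipole_energy // -(mulmxA _ (mpinv _)).
have Lp := laplacian_mpinv_dipole uv; move: Lp.
move: (mpinv _ *m _) (dipole_norm nuv); set x := (delta_mx u 0 - delta_mx v 0).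
set L := laplacian R G => p xx Lp.
have pL : p^T *m L = x^T by rewrite -Lp trmx_mul trmx_laplacian.
clearbody x; have := laplacian_energy_ge0 G (p - t *: x); rewrite -/L.
(* With [p = L^+ x] and [L p = x], the term [p^T L p] is the resistance [x^T p], and each cross term
   is [- t x^T x]. *)
have -> : (p - t *: x)^T *m L *m (p - t *: x) =
    x^T *m p - (2 * t) *: (x^T *m x) + t ^+ 2 *: (x^T *m L *m x).
  rewrite [(p - t *: x)^T]linearB /= [(t *: x)^T]linearZ /= mulmxBl pL -scalemxAl.
  rewrite mulmxBr !mulmxBl.
  rewrite -!scalemxAl -!scalemxAr -(mulmxA _ L p) Lp scalerA -expr2.
  by rewrite opprB mulr_natl mulr2n scalerDl opprD !addrA [LHS]addrAC.
move: (x^T *m p) (x^T *m x) xx (x^T *m L *m x) => a b bE c.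
rewrite !mxE bE; lra.
Qed.

Lemma deg_le G u : (deg G u <= n.-1)%N.
Proof.
have -> : n.-1 = #|[set~ u]| by rewrite cardsC1 card_ord.
apply/subset_leq_card/fintype.subsetP => w; rewrite !inE => uw.
by apply: contraTneq uw => ->; rewrite adj_irr.
Qed.

Lemma deg_full_adj G u v : deg G u = n.-1 -> u != v -> adj G u v.
Proof.
move=> du uv.
have /eqP E : [set w | adj G u w] == [set~ u].
  rewrite eqEcard du cardsC1 card_ord leqnn andbT.
  apply/fintype.subsetP => w; rewrite !inE => uw.
  by apply: contraTneq uw => ->; rewrite adj_irr.
by have : v \in [set~ u] by [rewrite !inE eq_sym]; rewrite -E inE.
Qed.

Lemma eff_res_clique_adj_deg G u v : adj G u v -> eff_res R G u v = 2 / n%:R ->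
  deg G u = n.-1 /\ deg G v = n.-1.
Proof.
move=> uv Ruv; have n0 : (0 < n)%N by case: (n) u {v uv Ruv} => [[]|].
(* The bound is best at [t = 2 / (deg u + deg v + 2)], which is [1 / n] when both degrees are
   [n - 1]. Clearing denominators then gives [deg u + deg v >= 2n - 2]. *)
have := eff_res_adj_ge (n%:R^-1) uv; rewrite Ruv.
have nR : (0 : R) < n%:R by rewrite ltr0n.
rewrite -(ler_pM2l (exprn_gt0 2 nR)).
have -> : n%:R ^+ 2 * (4 * n%:R^-1 - n%:R^-1 ^+ 2 * (deg G u + deg G v + 2)%:R)
    = 4 * n%:R - (deg G u + deg G v + 2)%:R :> R by field; rewrite gt_eqF.
have -> : n%:R ^+ 2 * (2 / n%:R) = 2 * n%:R :> R by field; rewrite gt_eqF.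
move=> H; have {}H : (2 * n <= deg G u + deg G v + 2)%N.
  by rewrite -(ler_nat R) natrM; lra.
have := deg_le G u; have := deg_le G v.
move: (deg G u) (deg G v) H n0 => a b H n0; lia.
Qed.

(** The dipole has zero sum, so it is an eigenvector of the Laplacian of [K_n] with eigenvalue [n],
    and [L^+] divides it by [n]. *)
Lemma eff_res_complete u v : u != v ->
  eff_res R (complete_graph n) u v = 2 / n%:R.
Proof.
move=> uv; have n0 : n%:R != 0 :> R.
  by rewrite pnatr_eq0; case: (n) u {v uv} => [[]|].
have := @mpinv_laplacian_dipole (complete_graph n) u v uv.
have -> : laplacian R (complete_graph n) *m dipole u v = n%:R *: dipole u v.
  apply/colP => i; rewrite laplacian_mulE.
  set z := dipole u v.
  have z0 : \sum_j z j 0 = 0.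
    rewrite (eq_bigr (fun j => (j == u)%:R - (j == v)%:R)) => [|j _]; last first.
      by rewrite !mxE !andbT.
    have one (a : 'I_n) : \sum_j (j == a)%:R = 1 :> R.
      by rewrite (bigD1 a) //= eqxx big1 ?addr0 // => j /negPf ->.
    by rewrite sumrB !one subrr.
  rewrite (eq_bigr (fun j => z i 0 - z j 0)) => [|j _]; last first.
    by rewrite /=; case: eqVneq => [->|_]; rewrite ?subrr ?mulr0 ?mul1r.
  by rewrite sumrB z0 subr0 sumr_const card_ord [RHS]mxE mulr_natl.
rewrite -scalemxAr => E.
rewrite /eff_res /= -mulmxA.
have -> : mpinv (laplacian R (complete_graph n)) *m dipole u v =
    n%:R^-1 *: dipole u v by rewrite -[in RHS]E scalerA mulVf // scale1r.
by rewrite -scalemxAr mxE dipole_norm // mulrC.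
Qed.

(** The dipole is in the kernel of [L], and the Penrose conditions with the symmetry of [L] give
    [L^+ = L^+ (L^+)^T L], so [L^+] kills it too. *)
Lemma eff_res_isolated G u v :
  (forall w, ~~ adj G u w) -> (forall w, ~~ adj G v w) -> eff_res R G u v = 0.
Proof.
move=> iu iv; have [_ p2 p3 _] := mpinvP (laplacian R G).
have Lx : laplacian R G *m dipole u v = 0.
  apply/colP => i; rewrite laplacian_mulE [RHS]mxE big1 // => j _.
  case ij: (adj G i j); last by rewrite mul0r.
  have [iu' iv'] : i != u /\ i != v.
    by split; apply: contraTneq ij => ->.
  have [ju' jv'] : j != u /\ j != v.
    by split; apply: contraTneq ij => ->; rewrite adj_sym.
  by rewrite !mxE (negPf iu') (negPf iv') (negPf ju') (negPf jv') /= subrr mulr0.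
rewrite /eff_res -mulmxA -p2 -[X in _ *m (X *m _)]mulmxA -p3 trmx_mul.
by rewrite trmx_laplacian -!mulmxA Lx !mulmx0 mxE.
Qed.

Lemma clique_two_stars G u v : u != v ->
  (forall w, u != w -> eff_res R G u w = 2 / n%:R) ->
  (forall w, v != w -> eff_res R G v w = 2 / n%:R) ->
  is_clique G.
Proof.
move=> uv Hu Hv.
have n0 : n%:R != 0 :> R by rewrite pnatr_eq0; case: (n) u {v uv Hu Hv} => [[]|].
(* One star suffices once its centre [s] has a neighbour: that edge forces [deg s = n - 1], so [s]
   is adjacent to every other [a], and the edge from [s] to [a] forces [deg a = n - 1]. *)
have full s : (forall w, s != w -> eff_res R G s w = 2 / n%:R) ->
    (exists w, adj G s w) -> is_clique G.
  move=> Hs [w sw].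
  have neq a b : adj G a b -> a != b.
    by move=> ab; apply: contraTneq ab => ->; rewrite adj_irr.
  have [ds _] := eff_res_clique_adj_deg sw (Hs _ (neq _ _ sw)).
  have dall a : deg G a = n.-1.
    have [<- //|sa] := eqVneq s a.
    by have [] := eff_res_clique_adj_deg (deg_full_adj ds sa) (Hs _ sa).
  apply/forallP => a; apply/forallP => b; rewrite /=.
  have [->|ab] := eqVneq a b; first by rewrite adj_irr.
  by rewrite deg_full_adj.
have [/existsP/(full u Hu) //|/existsPn iu] := boolP [exists w, adj G u w].
have [/existsP/(full v Hv) //|/existsPn iv] := boolP [exists w, adj G v w].
have /esym/eqP := eff_res_isolated iu iv.
by rewrite Hu // eq_sym mulf_eq0 invr_eq0 (negPf n0) pnatr_eq0.
Qed.

End Resistance.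

(** * The tester with linearly many resistance queries *)

Fixpoint all_answers (V : Type) (A : eqType) (c : A) (s : seq (V * V)) : qalg V A :=
  if s is (u, v) :: s' then
    Query u v (fun a => if a == c then all_answers c s' else Output false)
  else Output true.

Lemma output_all_answers (V : Type) (A : eqType) (o : V -> V -> A) c s :
  output o (all_answers c s) = all (fun p => o p.1 p.2 == c) s.
Proof. by elim: s => [|[u v] s IHs] //=; case: eqP. Qed.

Lemma num_queries_all_answers (V : Type) (A : eqType) (o : V -> V -> A) c s :
  (num_queries o (all_answers c s) <= size s)%N.
Proof. by elim: s => [|[u v] s IHs] //=; case: eqP. Qed.

(** Diagonal pairs are dropped because their resistance is 0 even in [K_n]; [take 2] lets the
    definition make sense for [n < 2]. *)
Definition two_stars n : seq ('I_n * 'I_n) :=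
  [seq p <- [seq (u, v) | u <- take 2 (enum 'I_n), v <- enum 'I_n] | p.1 != p.2].

Lemma size_two_stars n : (size (two_stars n) <= 2 * n)%N.
Proof.
rewrite size_filter (leq_trans (count_size _ _)) // size_allpairs size_enum_ord.
by rewrite leq_mul2r size_take_min geq_minl orbT.
Qed.

Lemma two_stars_test (R : realType) n (G : sgraph n) :
  all (fun p => eff_res R G p.1 p.2 == 2 / n%:R) (two_stars n) = is_clique G.
Proof.
apply/idP/idP => [/allP H|/forallP H].
  (* Two distinct centres do not exist here, but a graph with at most one vertex is a clique. *)
  have [n1|n2] := leqP n 1.
    have E (a b : 'I_n) : a = b.
      by apply: val_inj; move: (ltn_ord a) (ltn_ord b) n1 => /=; lia.
    apply/forallP => a; apply/forallP => b.
    by rewrite (E a b) adj_irr /= eqxx.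
  have : size (take 2 (enum 'I_n)) = 2%N.
    by rewrite size_take_min size_enum_ord; apply/minn_idPl.
  have := take_uniq 2 (enum_uniq 'I_n).
  move: H; rewrite /two_stars; case: take => [|u [|v []]] //= H.
  rewrite inE andbT => uv _.
  apply: (@clique_two_stars R n G u v uv) => w nw; apply/eqP.
    apply: (H (u, w)); rewrite mem_filter /= nw.
    by rewrite !mem_cat map_f // mem_enum.
  apply: (H (v, w)); rewrite mem_filter /= nw.
  by rewrite !mem_cat [_ \in [seq (v, _) | _ <- _]]map_f ?orbT // mem_enum.
apply/allP => -[u v]; rewrite mem_filter /= => /andP[uv _].
rewrite -(eff_res_complete R uv) /eff_res.
suff -> : laplacian R G = laplacian R (complete_graph n) by [].
have E a b : adj G a b = adj (complete_graph n) a b.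
  by apply/eqP; have /forallP := H a.
apply/matrixP => a b; rewrite !mxE E; congr (if _ then _ %:R else _).
by apply: eq_card => w; rewrite !inE E.
Qed.

(** * Distances in the complete graph and after deleting one edge *)

Lemma sp_dist_refl n (G : sgraph n) u : sp_dist G u u = Some 0%N.
Proof.
have P0 : has_path G u u 0 by apply/existsP; exists [tuple]; rewrite /= eqxx.
have := sp_distP G u u; case: sp_dist => [k [_ /(_ _ P0)]|/(_ 0%N)].
  by rewrite leqn0 => /eqP ->.
by rewrite P0.
Qed.

Lemma sp_dist_adj n (G : sgraph n) u v : adj G u v -> sp_dist G u v = Some 1%N.
Proof.
move=> uv; have nuv : u != v by apply: contraTneq uv => ->; rewrite adj_irr.
have P1 : has_path G u v 1.
  by apply/existsP; exists [tuple v]; rewrite /= uv eqxx inE nuv.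
have := sp_distP G u v; case: sp_dist => [k [Pk /(_ _ P1)]|/(_ 1%N)]; last first.
  by rewrite P1.
case: k Pk => [|[|]] // /existsP[p]; rewrite (tuple0 p) /=.
by rewrite (negPf nuv).
Qed.

Section Punctured.
Variables (n : nat) (e : 'I_n * 'I_n).

Definition punctured_adj (u v : 'I_n) :=
  [&& u != v, (u, v) != e & (v, u) != e].

Lemma punctured_sym : symmetric punctured_adj.
Proof. by move=> u v; rewrite /punctured_adj eq_sym; congr andb; rewrite andbC. Qed.

Lemma punctured_irr : irreflexive punctured_adj.
Proof. by move=> u; rewrite /punctured_adj eqxx. Qed.

Definition punctured : sgraph n := SGraph punctured_sym punctured_irr.

Lemma punctured_not_clique : e.1 != e.2 -> is_clique punctured = false.
Proof.
move=> ne; apply/negP => /forallP/(_ e.1)/forallP/(_ e.2).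
by rewrite /= /punctured_adj ne -surjective_pairing eqxx.
Qed.

(** Distinct vertices other than the ends of [e] taken together stay adjacent, so their distance is
    1 in both graphs. *)
Lemma sp_dist_punctured u v : (u, v) != e -> (v, u) != e ->
  sp_dist punctured u v = sp_dist (complete_graph n) u v.
Proof.
move=> e1 e2; have [->|uv] := eqVneq u v; first by rewrite !sp_dist_refl.
by rewrite !sp_dist_adj //= /punctured_adj uv e1.
Qed.

End Punctured.

(** * Queries along a run and the edges that a tree can detect *)

Fixpoint queries (V A : Type) (o : V -> V -> A) (T : qalg V A) : seq (V * V) :=
  if T is Query u v k then (u, v) :: queries o (k (o u v)) else [::].

Lemma size_queries (V A : Type) (o : V -> V -> A) T :
  size (queries o T) = num_queries o T.
Proof. by elim: T => [//|u v k IH] /=; rewrite IH. Qed.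

(** Equal answers lead both runs into the same subtree, so agreement along the run of [o] alone is
    enough for adaptive trees. *)
Lemma output_eq_on_queries (V : eqType) (A : Type) (o o' : V -> V -> A) T :
  {in queries o T, forall p, o p.1 p.2 = o' p.1 p.2} -> output o T = output o' T.
Proof.
elim: T => [//|u v k IH] /= H; rewrite -(H (u, v)) ?mem_head //.
by apply: IH => p pq; apply: H; rewrite inE pq orbT.
Qed.

Definition distinguished n (T : qalg 'I_n (option nat)) : {set 'I_n * 'I_n} :=
  [set e | (e.1 != e.2) && (output (sp_dist (complete_graph n)) T
                            != output (sp_dist (punctured e)) T)].

(* Edges are counted as ordered pairs, so that one query accounts for two. *)
Lemma card_distinguished n (T : qalg 'I_n (option nat)) :
  (#|distinguished T| <= 2 * num_queries (sp_dist (complete_graph n)) T)%N.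
Proof.
rewrite -size_queries; set q := queries _ T.
have sub : distinguished T \subset q ++ [seq (p.2, p.1) | p <- q].
  apply/fintype.subsetP => e; rewrite inE => /andP[_]; apply: contraR.
  rewrite mem_cat negb_or => /andP[e1 e2]; apply/eqP.
  apply: output_eq_on_queries => p pq; rewrite sp_dist_punctured //.
    by rewrite -surjective_pairing; apply: contraNneq e1 => <-.
  by apply: contraNneq e2 => <-; apply: (map_f (fun p => (p.2, p.1))).
rewrite (leq_trans (subset_leq_card sub)) // (leq_trans (card_size _)) //.
by rewrite size_cat size_map mul2n addnn.
Qed.

Lemma card_neq_pairs n : #|[set e : 'I_n * 'I_n | e.1 != e.2]| = (n * n.-1)%N.
Proof.
rewrite -sum1_card (eq_bigl (fun e => predT e.1 && (e.1 != e.2))); last first.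
  by move=> e; rewrite inE.
rewrite -(pair_big_dep predT (fun u v : 'I_n => u != v) (fun _ _ => 1%N)) /=.
rewrite (eq_bigr (fun=> n.-1)) ?sum_nat_const ?card_ord // => u _.
rewrite sum1_card -[in RHS](card_ord n) -(cardC1 u).
by apply: eq_card => v; rewrite !inE eq_sym.
Qed.

(** * Averaging over a randomized tester *)

Section LowerBound.
Local Open Scope classical_set_scope.
Variables (R : realType) (d : measure_display) (T : measurableType d).
Variable P : probability T R.

(** Inclusion-exclusion, with the probability of the union at most 1. *)
Lemma probability_setI_ge (A B : set T) (a b : R) :
  measurable A -> measurable B -> (a%:E <= P A)%E -> (b%:E <= P B)%E ->
  ((a + b - 1)%:E <= P (A `&` B))%E.
Proof.
move=> mA mB aA bB.
have mAB : measurable (A `|` B) by exact: measurableU.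
have mI : measurable (A `&` B) by exact: measurableI.
have : (P A + P B - P (A `&` B) <= 1)%E.
  rewrite -measureUfinl ?probability_le1 //.
  by rewrite ltey_eq fin_num_measure.
move: aA bB; rewrite -(fineK (fin_num_measure P _ mA)).
rewrite -(fineK (fin_num_measure P _ mB)) -(fineK (fin_num_measure P _ mI)).
rewrite -EFinN -!EFinD !lee_fin; lra.
Qed.

(** By linearity of expectation the sum is the mean number of events that occur, which is at most
    [K] pointwise. *)
Lemma sum_probability_le (I : Type) (s : seq I) (E : I -> set T) (K : R) :
  (forall i, measurable (E i)) ->
  (forall w, (count (fun i => w \in E i) s)%:R <= K) ->
  (\sum_(i <- s) P (E i) <= K%:E)%E.
Proof.
move=> mE EK.
have mindic i : measurable_fun setT (EFin \o (\1_(E i) : T -> R)).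
  by apply/measurable_EFinP; exact: measurable_indic.
rewrite (eq_bigr (fun i => \int[P]_w (\1_(E i) w)%:E)%E) => [|i _]; last first.
  by rewrite integral_indic // setIT.
rewrite -ge0_integral_sum //.
apply: (@le_trans _ _ (\int[P]_w cst K%:E w)%E); last first.
  by rewrite integral_cst // [X in (_ * X)%E](@probability_setT _ _ _ P) mule1.
apply: ge0_le_integral => //.
- by move=> w _; apply: sume_ge0 => i _; rewrite lee_fin.
- exact: emeasurable_sum.
move=> w _; rewrite /= sumEFin lee_fin (le_trans _ (EK w)) //.
rewrite -sum1_count natr_sum [leRHS]big_mkcond /=.
by apply: ler_sum => i _; rewrite indicE; case: (_ \in _).
Qed.

Lemma distinguished_prob n (A : T -> qalg 'I_n (option nat)) e :
  randomized_sp_clique_tester P A -> e.1 != e.2 ->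
  measurable [set w | e \in distinguished (A w)] /\
  ((3^-1)%:E <= P [set w | e \in distinguished (A w)])%E.
Proof.
move=> HA ne.
pose K := [set w | output (sp_dist (complete_graph n)) (A w)].
pose Q := [set w | output (sp_dist (punctured e)) (A w)].
have [mK PK] := HA (complete_graph n); have [mQ PQ] := HA (punctured e).
have cK : is_clique (complete_graph n).
  by apply/forallP => u; apply/forallP => v.
rewrite cK in PK; rewrite punctured_not_clique // in PQ.
(* Measurability comes from the acceptance events [K] and [Q]. The bound comes from [K] minus [Q],
   where both graphs are answered correctly. *)
have -> : [set w | e \in distinguished (A w)] = (K `\` Q) `|` (Q `\` K).
  apply/seteqP; split => w /=; rewrite inE ne /= /K /Q /=.
    by case: output; case: output => //= _; [left|right].
  by case=> -[]; case: output; case: output.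
have mKQ : measurable (K `\` Q) by exact: measurableD.
have mD : measurable ((K `\` Q) `|` (Q `\` K)).
  by apply: measurableU => //; exact: measurableD.
split=> //; apply: (@le_trans _ _ (P (K `\` Q))); last first.
  by apply: le_measure; rewrite ?inE //; exact: subsetUl.
have -> : 3^-1 = 2 / 3 + 2 / 3 - 1 :> R by lra.
rewrite setDE; apply: probability_setI_ge => //; first exact: measurableC.
rewrite (_ : ~` Q = [set w | output (sp_dist (punctured e)) (A w) = false]) //.
by apply/seteqP; split => w; rewrite /Q /=; case: output => // /(_ isT).
Qed.

(** If every tree made fewer than [n^2 / 24] queries on [K_n], each would distinguish fewer than
    [n^2 / 12] ordered pairs; yet the mean number distinguished is at least [n (n - 1) / 3], which
    is larger for [n >= 2]. *)
Lemma sp_tester_queries n (A : T -> qalg 'I_n (option nat)) : (2 <= n)%N ->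
  randomized_sp_clique_tester P A ->
  exists w, 24^-1 * n%:R ^+ 2
    <= (num_queries (sp_dist (complete_graph n)) (A w))%:R :> R.
Proof.
move=> n2 HA; apply: contrapT => few.
pose s := enum [set e : 'I_n * 'I_n | e.1 != e.2]%SET.
(* The default [set0] makes [E e] measurable on the diagonal as well, as [sum_probability_le]
   requires. *)
pose E (e : 'I_n * 'I_n) :=
  if e.1 != e.2 then [set w | e \in distinguished (A w)] else set0.
have mE e : measurable (E e).
  by rewrite /E; case: ifP => // /(distinguished_prob HA)[].
have /(sum_probability_le mE) : forall w,
    (count (fun e => w \in E e) s)%:R <= 12^-1 * n%:R ^+ 2 :> R.
  move=> w.
  have q_lt : (num_queries (sp_dist (complete_graph n)) (A w))%:R
      < 24^-1 * n%:R ^+ 2 :> R.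
    by rewrite ltNge; apply/negP => H; apply: few; exists w.
  have le_q : (count (fun e => w \in E e) s <=
      2 * num_queries (sp_dist (complete_graph n)) (A w))%N.
    apply: leq_trans (card_distinguished (A w)).
    rewrite -size_filter -(card_uniqP (filter_uniq _ (enum_uniq _))).
    apply/subset_leq_card/fintype.subsetP => e; rewrite mem_filter mem_enum inE.
    by case/andP => /set_mem + ne; rewrite /E ne.
  rewrite -(ler_nat R) natrM in le_q; lra.
apply/negP; rewrite -ltNge.
apply: (@lt_le_trans _ _ (\sum_(e <- s) (3^-1)%:E)%E); last first.
  rewrite big_seq [leRHS]big_seq; apply: lee_sum => e.
  by rewrite mem_enum inE /E => ne; rewrite ne; have [] := distinguished_prob HA ne.
rewrite sumEFin lte_fin big_enum /= sumr_const card_neq_pairs.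
rewrite -[ltRHS]mulr_natl natrM.
case: n n2 {A HA few s E mE} => // m m1; rewrite /= -[m.+1%:R]natr1.
have : (1 : R) <= m%:R by rewrite ler1n.
move: (m%:R) => x x1; rewrite -subr_gt0.
(* Here [x = n - 1 >= 1], so both factors of the gap are positive. *)
have -> : (x + 1) * x * 3^-1 - 12^-1 * (x + 1) ^+ 2
    = 12^-1 * ((x + 1) * (3 * x - 1)) by field.
by rewrite mulr_gt0 ?invr_gt0 // mulr_gt0 //; lra.
Qed.

End LowerBound.

Theorem mainTheorem8 (R : realType) :
  (exists (C : nat) (A : forall n : nat, qalg 'I_n R),
     forall (n : nat) (G : sgraph n),
       output (eff_res R G) (A n) = is_clique G /\
       (num_queries (eff_res R G) (A n) <= C * n)%N)
  /\
  (exists (c : R) (n0 : nat), 0 < c /\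
     forall n : nat, (n0 <= n)%N ->
     forall (d : measure_display) (Omega : measurableType d)
            (P : probability Omega R) (A : Omega -> qalg 'I_n (option nat)),
       randomized_sp_clique_tester P A ->
       exists (w : Omega) (G : sgraph n),
         c * n%:R ^+ 2 <= (num_queries (sp_dist G) (A w))%:R).
Proof.
split.
  exists 2%N, (fun n => all_answers (2 / n%:R) (two_stars n)) => n G; split.
    by rewrite output_all_answers two_stars_test.
  exact: leq_trans (num_queries_all_answers _ _ _) (size_two_stars n).
exists 24^-1, 2%N; split=> [|n n2 d Omega P A HA]; first by rewrite invr_gt0.
have [w Hw] := sp_tester_queries n2 HA.
(* The hard input is the clique itself, whatever the tester. *)
by exists w, (complete_graph n).
Qed.
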